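(* Let $c \ge 2$ and write $c = 3s + t$ with $s \in \mathbb{N}_0$ and $t \in \{2,3,4\}$ (these are uniquely determined). Consider the Static Black-Peg AB Game with $p=2$ pegs and $c$ colors, and the list of questions obtained as follows. First take the base questions: for $t=2$ the single question $(1\,|\,2)$; for $t=3$ the questions $(1\,|\,2),(3\,|\,1)$; for $t=4$ the questions $(1\,|\,3),(3\,|\,1),(2\,|\,3),(3\,|\,2)$. Then, for each $l=1,2,\dots,s$, append the four questions $(1+d_l\,|\,3+d_l)$, $(3+d_l\,|\,1+d_l)$, $(2+d_l\,|\,3+d_l)$, $(3+d_l\,|\,2+d_l)$, where $d_l = t+3(l-1)$. This list consists of exactly $\lceil 4c/3\rceil-2$ questions, and it is a feasible and optimal $(\lceil 4c/3 \rceil-1)$-strategy; that is, the answers to these questions uniquely determine every secret, and no feasible strategy consisting of fewer than $\lceil 4c/3\rceil-2$ questions exists.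
   Context: Static Black-Peg AB Game with $p$ pegs and $c \ge p$ colors: the colors are $1,2,\dots,c$. A secret and a question are both ordered $p$-tuples $(x_1\,|\,x_2\,|\,\dots\,|\,x_p)$ of pairwise distinct colors. The answer to a question $Q=(q_1\,|\,\dots\,|\,q_p)$ for a secret $S=(s_1\,|\,\dots\,|\,s_p)$ is the number of positions (pegs) $i$ with $q_i=s_i$. A strategy is a list of $k$ pairwise distinct questions (the main questions) which the codebreaker asks all at once at the beginning; it is called a $(k+1)$-strategy (the extra one counting the final question, which is the secret itself). The strategy is feasible if any two distinct secrets receive different vectors of answers to the $k$ questions. A $(k+1)$-strategy is optimal if it is feasible and there is no feasible strategy with fewer than $k$ questions. *)

(* Defs.v *)
From mathcomp Require Import all_boot all_order all_algebra.

Set Implicit Arguments.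
Unset Strict Implicit.
Unset Printing Implicit Defensive.

Import Order.TTheory GRing.Theory Num.Theory.

(* Colors are the naturals 1, ..., c; secrets and questions share this
   predicate. *)
Definition code (p c : nat) (x : p.-tuple nat) : bool :=
  uniq x && all (fun a => 1 <= a <= c) x.

Definition answer (p : nat) (Q S : p.-tuple nat) : nat :=
  #|[set i : 'I_p | tnth Q i == tnth S i]|.

Definition answers (p : nat) (qs : seq (p.-tuple nat)) (S : p.-tuple nat) :
  seq nat := [seq answer Q S | Q <- qs].

Definition strategy (p c : nat) (qs : seq (p.-tuple nat)) : Prop :=
  uniq qs /\ all (@code p c) qs.

(* The index n also counts the final question, which is not in [qs]. *)
Definition nstrategy (p c : nat) (n : int) (qs : seq (p.-tuple nat)) : Prop :=
  strategy c qs /\ n = ((size qs)%:Z + 1)%R.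

Definition feasible (p c : nat) (qs : seq (p.-tuple nat)) : Prop :=
  forall S S' : p.-tuple nat, code c S -> code c S' ->
    S <> S' -> answers qs S <> answers qs S'.

Definition optimal (p c : nat) (n : int) (qs : seq (p.-tuple nat)) : Prop :=
  [/\ nstrategy c n qs,
      feasible c qs &
      ~ exists qs' : seq (p.-tuple nat),
          [/\ strategy c qs', feasible c qs' & size qs' < size qs]].

Definition question2 (a b : nat) : 2.-tuple nat := [tuple a; b].

Definition base_questions (t : nat) : seq (2.-tuple nat) :=
  match t with
  | 2 => [:: question2 1 2]
  | 3 => [:: question2 1 2; question2 3 1]
  | 4 => [:: question2 1 3; question2 3 1; question2 2 3; question2 3 2]
  | _ => [::]
  end.

Definition block (d : nat) : seq (2.-tuple nat) :=
  [:: question2 (1 + d) (3 + d); question2 (3 + d) (1 + d);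
      question2 (2 + d) (3 + d); question2 (3 + d) (2 + d)].

Definition questions (s t : nat) : seq (2.-tuple nat) :=
  base_questions t ++ flatten [seq block (t + 3 * (l - 1)) | l <- iota 1 s].

(* Main.v *)
(* A question (a | b) is an edge from the peg-1 color a to the peg-2 color b of
   a bipartite graph on 2c vertices, and the answer to it is the number of its
   endpoints in the secret.  Lower bound for k questions: let n0 be the number
   of isolated vertices and n1 the number of edges that form a component of
   their own.  The degrees sum to 2k and at most k + n1 vertices are leaves,
   hence 4c <= 3k + 2 n0 + n1.  For c > 2, feasibility allows at most one
   isolated vertex per side, at most three isolated edges, and at most two of
   them when both sides have an isolated vertex, so 2 n0 + n1 <= 6.
   Feasibility of the list: the four answers to a block determine which of its
   colors occur on which peg; colors outside all blocks are then separated by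
   the base questions. *)
Require Import Defs.
From mathcomp Require Import all_boot all_order all_algebra.
From mathcomp Require Import zify.

Set Implicit Arguments.
Unset Strict Implicit.
Unset Printing Implicit Defensive.

Import Order.TTheory GRing.Theory Num.Theory.

(** * Two-peg codes and feasibility in terms of colors *)

Notation peg1 Q := (tnth Q (ord0 : 'I_2)).
Notation peg2 Q := (tnth Q (ord_max : 'I_2)).

Lemma code2E c (Q : 2.-tuple nat) :
  code c Q = [&& peg1 Q != peg2 Q, 1 <= peg1 Q <= c & 1 <= peg2 Q <= c].
Proof.
case/tupleP: Q => a Q; case/tupleP: Q => b Q; rewrite (tuple0 Q).
by rewrite /code /= !inE !(tnth_nth 0) /= !andbT.
Qed.

Lemma answer2E (Q S : 2.-tuple nat) :
  answer Q S = (peg1 Q == peg1 S) + (peg2 Q == peg2 S).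
Proof.
rewrite /answer -sum1dep_card big_mkcond big_ord_recl big_ord1 /=.
have -> : lift ord0 ord0 = ord_max :> 'I_2 by apply: val_inj.
by do 2!case: (_ == _).
Qed.

Lemma tuple2_inj (Q S : 2.-tuple nat) :
  peg1 Q = peg1 S -> peg2 Q = peg2 S -> Q = S.
Proof.
move=> h1 h2; apply: eq_from_tnth => -[[|[|//]] i].
  by rewrite (_ : Ordinal i = ord0) //; apply: val_inj.
by rewrite (_ : Ordinal i = ord_max) //; apply: val_inj.
Qed.

Definition separating c (qs : seq (2.-tuple nat)) :=
  forall x y x' y' : nat, x != y -> x' != y' ->
    0 < x <= c -> 0 < y <= c -> 0 < x' <= c -> 0 < y' <= c ->
    {in qs, forall Q, (peg1 Q == x) + (peg2 Q == y) =
                      (peg1 Q == x') + (peg2 Q == y')} ->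
    x = x' /\ y = y'.

Lemma feasible2P c qs : feasible c qs <-> separating c qs.
Proof.
split=> [F x y x' y' nxy nxy' x_c y_c x'_c y'_c E | F S S'].
  have [eqS | /eqP neS] := eqVneq (question2 x y) (question2 x' y').
    by case: eqS.
  case: (F _ _ _ _ neS).
  - by rewrite code2E !(tnth_nth 0) /= nxy x_c.
  - by rewrite code2E !(tnth_nth 0) /= nxy' x'_c.
  - by apply/eq_in_map => Q /E; rewrite !answer2E !(tnth_nth 0).
rewrite !code2E => /and3P[n x_c y_c] /and3P[n' x'_c y'_c] neS /eq_in_map E.
apply: neS; have [|] := F _ _ _ _ n n' x_c y_c x'_c y'_c.
  by move=> Q /E; rewrite !answer2E.
exact: tuple2_inj.
Qed.

(** * Degree counting on one side of the graph *)

Lemma double_size_le (r s : seq nat) : uniq r -> {subset s <= r} ->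
  2 * size r <= 2 * count (fun a => a \notin s) r + size s
                + count (fun a => count_mem a s == 1) s.
Proof.
move=> r_uniq sr.
have sumE (f : nat -> nat) :
    \sum_(b <- s) f b = \sum_(a <- r) count_mem a s * f a.
  under [RHS]eq_bigr => a _ do rewrite -sum1_count big_mkcond big_distrl /=.
  rewrite exchange_big /=; apply: eq_big_seq => b /sr rb.
  rewrite (bigD1_seq b) //= eqxx mul1n big1 ?addn0 // => a.
  by rewrite eq_sym => /negbTE->.
have countE (p : pred nat) l : count p l = \sum_(a <- l) p a.
  by rewrite -sum1_count big_mkcond; apply: eq_bigr => a _; case: (p a).
(* The inequality now holds for each vertex: an isolated one contributes 2, a leaf 1 + 1, any other
   at least its degree, which is 2 or more. *)
rewrite -(sum1_size s) (countE _ s) !sumE countE -(sum1_size r).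
rewrite !big_distrr -!big_split /=; apply: leq_sum => a _.
rewrite -has_pred1 has_count; case: (count_mem a s) => [|[|n]] //=; lia.
Qed.

(** With [f] a peg, this says that a leaf of the graph identifies its edge. *)
Lemma leaf_eq (T T' : eqType) (f : T -> T') (s : seq T) (x y : T) :
  count_mem (f x) (map f s) = 1 -> x \in s -> y \in s ->
  (f y == f x) = (y == x).
Proof.
move=> h xs ys; apply/eqP/eqP => [e|->//]; move: h xs ys.
elim: s => //= z s IH.
rewrite !inE; have [e0|n0] := eqVneq (f z) (f x); last first.
  rewrite add0n => /IH {}IH /predU1P[xz|xs] /predU1P[yz|ys]; try exact: IH.
  - by rewrite xz yz.
  - by rewrite xz eqxx in n0.
  - by rewrite -yz e eqxx in n0.
move=> [] /eqP; rewrite -leqn0 leqNgt -has_count has_pred1 => h.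
have m u : u \in s -> f u = f x -> False.
  by move=> us fu; rewrite -fu map_f in h.
move=> /predU1P[->|/m//] /predU1P[->//|/m]; case; exact/e.
Qed.

Lemma count_le1 (T : eqType) (a : pred T) (s : seq T) : uniq s ->
  {in s &, forall x y, a x -> a y -> x = y} -> count a s <= 1.
Proof.
move=> us h; rewrite -size_filter.
have := filter_uniq a us.
have: {in [seq x <- s | a x] &, forall x y, x = y}.
  move=> x y; rewrite !mem_filter => /andP[ax xs] /andP[ay ys]; exact: h.
case: [seq x <- s | a x] => [|x [|y l]] //= e.
by rewrite (e x y) !inE ?eqxx ?orbT.
Qed.

(** * Lower bound on the number of questions *)

Section LowerBound.

Variables (c : nat) (qs : seq (2.-tuple nat)).
Hypothesis qs_code : all (@code 2 c) qs.
Hypothesis qs_uniq : uniq qs.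
Hypothesis qs_sep : separating c qs.

Let left := [seq peg1 Q | Q <- qs].
Let right := [seq peg2 Q | Q <- qs].

(** Both endpoints are leaves: the edge is a component of its own. *)
Definition lonely (Q : 2.-tuple nat) :=
  (count_mem (peg1 Q) left == 1) && (count_mem (peg2 Q) right == 1).

Lemma peg1_code Q : Q \in qs -> 0 < peg1 Q <= c.
Proof. by move/(allP qs_code); rewrite code2E => /and3P[]. Qed.

Lemma peg2_code Q : Q \in qs -> 0 < peg2 Q <= c.
Proof. by move/(allP qs_code); rewrite code2E => /and3P[]. Qed.

Lemma peg_neq Q : Q \in qs -> peg1 Q <> peg2 Q.
Proof. by move/(allP qs_code); rewrite code2E => /and3P[/eqP]. Qed.

Lemma lonely_peg1 Q P : lonely Q -> Q \in qs -> P \in qs ->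
  (peg1 P == peg1 Q) = (P == Q).
Proof.
by move=> /andP[/eqP h _]; apply: (leaf_eq (f := fun Q => peg1 Q)).
Qed.

Lemma lonely_peg2 Q P : lonely Q -> Q \in qs -> P \in qs ->
  (peg2 P == peg2 Q) = (P == Q).
Proof.
by move=> /andP[_ /eqP h]; apply: (leaf_eq (f := fun Q => peg2 Q)).
Qed.

Lemma notin_left x Q : x \notin left -> Q \in qs -> (peg1 Q == x) = false.
Proof.
move=> nx Qqs; apply/eqP => e; case/negP: nx; rewrite -e.
exact: (map_f (fun Q => peg1 Q)).
Qed.

Lemma notin_right y Q : y \notin right -> Q \in qs -> (peg2 Q == y) = false.
Proof.
move=> ny Qqs; apply/eqP => e; case/negP: ny; rewrite -e.
exact: (map_f (fun Q => peg2 Q)).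
Qed.

(* For [Q = (a | b)] and [P = (a' | b')], the secrets [(a | b')] and [(a' | b)]
   would otherwise get the same answers. *)
Lemma lonely_pair Q P : lonely Q -> lonely P -> Q \in qs -> P \in qs ->
  Q <> P -> peg1 Q = peg2 P \/ peg1 P = peg2 Q.
Proof.
move=> lQ lP Qqs Pqs nQP.
have [|n1] := eqVneq (peg1 Q) (peg2 P); first by left.
have [|n2] := eqVneq (peg1 P) (peg2 Q); first by right.
case: nQP; have [|||||] := qs_sep n1 n2; rewrite ?peg1_code ?peg2_code //.
  by move=> R Rqs; rewrite !lonely_peg1 ?lonely_peg2 // addnC.
by move=> /eqP; rewrite lonely_peg1 // => /eqP.
Qed.

(** Otherwise, for [Q = (a | b)], the secrets [(a | y)] and [(x | b)] would both get answer 1 from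
    [Q] and 0 from every other question. *)
Lemma lonely_isolated Q x y : lonely Q -> Q \in qs ->
  0 < x <= c -> 0 < y <= c -> x \notin left -> y \notin right ->
  peg1 Q = y \/ x = peg2 Q.
Proof.
move=> lQ Qqs x_c y_c nx ny.
have [|n1] := eqVneq (peg1 Q) y; first by left.
have [|n2] := eqVneq x (peg2 Q); first by right.
have [|||||] := qs_sep n1 n2; rewrite ?peg1_code ?peg2_code //.
  move=> R Rqs; rewrite lonely_peg1 // lonely_peg2 //.
  by rewrite notin_left // notin_right // addn0.
by move=> e; move: (notin_left nx Qqs); rewrite e eqxx.
Qed.

(** One of the colors 1, 2, 3 is a [y] different from [x] and [x']; no question tells [(x | y)] from
    [(x' | y)]. *)
Lemma isolated_left x x' : 2 < c -> 0 < x <= c -> 0 < x' <= c ->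
  x \notin left -> x' \notin left -> x = x'.
Proof.
move=> c3 x_c x'_c nx nx'.
have [y /and3P[y_c nxy nx'y]] : exists y, [&& 0 < y <= c, x != y & x' != y].
  have [e1|n1] := boolP ((x != 1) && (x' != 1)); first by exists 1; lia.
  have [e2|n2] := boolP ((x != 2) && (x' != 2)); first by exists 2; lia.
  by exists 3; lia.
have [|||||] // := qs_sep nxy nx'y.
move=> R Rqs; congr (nat_of_bool _ + _).
by rewrite !notin_left.
Qed.

Lemma isolated_right x x' : 2 < c -> 0 < x <= c -> 0 < x' <= c ->
  x \notin right -> x' \notin right -> x = x'.
Proof.
move=> c3 x_c x'_c nx nx'.
have [y /and3P[y_c nxy nx'y]] : exists y, [&& 0 < y <= c, y != x & y != x'].
  have [e1|n1] := boolP ((x != 1) && (x' != 1)); first by exists 1; lia.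
  have [e2|n2] := boolP ((x != 2) && (x' != 2)); first by exists 2; lia.
  by exists 3; lia.
have [|||||] // := qs_sep nxy nx'y.
move=> R Rqs; congr (_ + nat_of_bool _).
by rewrite !notin_right.
Qed.

Let lonelies := [seq Q <- qs | lonely Q].

Lemma lonely_nth Q0 i : i < size lonelies ->
  lonely (nth Q0 lonelies i) /\ nth Q0 lonelies i \in qs.
Proof. by move/(mem_nth Q0); rewrite mem_filter => /andP[]. Qed.

Lemma lonely_neq Q0 i j : i < size lonelies -> j < size lonelies -> i != j ->
  let Q := nth Q0 lonelies i in let P := nth Q0 lonelies j in
  [/\ Q <> P, peg1 Q <> peg1 P & peg2 Q <> peg2 P].
Proof.
move=> hi hj nij Q P.
have [lQ Qqs] := lonely_nth Q0 hi; have [lP Pqs] := lonely_nth Q0 hj.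
have nQP : Q <> P.
  by apply/eqP; rewrite nth_uniq // filter_uniq.
by split=> // /eqP; rewrite ?lonely_peg1 ?lonely_peg2 // => /eqP.
Qed.

(* Each of the [n(n-1)/2] pairs uses up one of at most [n] coincidences
   [peg1 Q = peg2 P]. *)
Lemma lonely_le3 : size lonelies <= 3.
Proof.
rewrite leqNgt; apply/negP => h.
pose Q i := nth (question2 0 0) lonelies i.
have N i j : i < 4 -> j < 4 -> i != j ->
    [/\ peg1 (Q i) = peg2 (Q j) \/ peg1 (Q j) = peg2 (Q i),
        peg1 (Q i) <> peg1 (Q j) & peg2 (Q i) <> peg2 (Q j)].
  move=> hi hj nij; have [nQ n1 n2] := lonely_neq (question2 0 0)
    (leq_trans hi h) (leq_trans hj h) nij; split=> //.
  have [lQ Qqs] := lonely_nth (question2 0 0) (leq_trans hi h).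
  have [lP Pqs] := lonely_nth (question2 0 0) (leq_trans hj h).
  exact: lonely_pair.
have [E01 a01 b01] := N 0 1 isT isT isT; have [E02 a02 b02] := N 0 2 isT isT isT.
have [E03 a03 b03] := N 0 3 isT isT isT; have [E12 a12 b12] := N 1 2 isT isT isT.
have [E13 a13 b13] := N 1 3 isT isT isT; have [E23 a23 b23] := N 2 3 isT isT isT.
clear N; case: E01 => E01; case: E02 => E02; try congruence.
all: case: E03 => E03; try congruence.
all: case: E12 => E12; try congruence.
all: case: E13 => E13; try congruence.
all: case: E23 => E23; congruence.
Qed.

(** By [lonely_isolated] each isolated edge has [y] on peg 1 or [x] on peg 2, and each of these two
    endpoints lies on at most one isolated edge. *)
Lemma lonely_le2 x y : 0 < x <= c -> 0 < y <= c ->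
  x \notin left -> y \notin right -> size lonelies <= 2.
Proof.
move=> x_c y_c nx ny; rewrite leqNgt; apply/negP => h.
pose Q i := nth (question2 0 0) lonelies i.
have N i j : i < 3 -> j < 3 -> i != j ->
    peg1 (Q i) <> peg1 (Q j) /\ peg2 (Q i) <> peg2 (Q j).
  by move=> hi hj nij; have [] := lonely_neq (question2 0 0)
    (leq_trans hi h) (leq_trans hj h) nij.
have I i : i < 3 -> peg1 (Q i) = y \/ x = peg2 (Q i).
  move=> hi; have [lQ Qqs] := lonely_nth (question2 0 0) (leq_trans hi h).
  exact: lonely_isolated.
have [a01 b01] := N 0 1 isT isT isT; have [a02 b02] := N 0 2 isT isT isT.
have [a12 b12] := N 1 2 isT isT isT.
have [I0 I1 I2] := And3 (I 0 isT) (I 1 isT) (I 2 isT); clear N I.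
by case: I0 => I0; case: I1 => I1; try congruence; case: I2 => I2; congruence.
Qed.

Lemma separating_size_ge : 2 <= c -> 4 * c <= 3 * size qs + 6.
Proof.
move=> c2; have [c3|] := ltnP 2 c; last first.
  (* For [c = 2] one question meets the bound, and without any question [(1 | 2)] and [(2 | 1)] look
     alike. *)
  case: (posnP (size qs)) => [/size0nil qs0|]; last by lia.
  have [|||||||] // := @qs_sep 1 2 2 1; rewrite ?c2 ?(ltnW c2) //.
  by rewrite qs0.
have hl : {subset left <= iota 1 c}.
  by move=> _ /mapP[Q /peg1_code Q_c ->]; rewrite mem_iota add1n ltnS.
have hr : {subset right <= iota 1 c}.
  by move=> _ /mapP[Q /peg2_code Q_c ->]; rewrite mem_iota add1n ltnS.
have := double_size_le (iota_uniq 1 c) hr.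
have := double_size_le (iota_uniq 1 c) hl.
rewrite !size_iota !size_map.
set il := count _ (iota 1 c); set ir := count _ (iota 1 c).
rewrite !count_map => B1 B2.
have il1 : il <= 1.
  apply: count_le1 (iota_uniq _ _) _ => x x'; rewrite !mem_iota => hx hx' nx nx'.
  by apply: isolated_left nx nx'; lia.
have ir1 : ir <= 1.
  apply: count_le1 (iota_uniq _ _) _ => x x'; rewrite !mem_iota => hx hx' nx nx'.
  by apply: isolated_right nx nx'; lia.
have E := lonely_le3.
have F : 0 < il -> 0 < ir -> size lonelies <= 2.
  rewrite -!has_count => /hasP[x hx nx] /hasP[y hy ny].
  by apply: lonely_le2 nx ny; move: hx hy; rewrite !mem_iota; lia.
(* Inclusion-exclusion on the edges with a left leaf and those with a right leaf: the graph has at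
   most [size qs + size lonelies] leaves. *)
set leafL := preim _ _ in B1; set leafR := preim _ _ in B2.
have := count_predUI leafL leafR qs.
have := count_size (predU leafL leafR) qs.
have -> : count (predI leafL leafR) qs = size lonelies by rewrite size_filter.
move: F E B1 B2 il1 ir1; clear; lia.
Qed.

End LowerBound.

(** * The list of questions: validity and length *)

Lemma questionsS s t :
  questions s.+1 t = questions s t ++ block (t + 3 * s).
Proof.
rewrite /questions -(addn1 s) iotaD map_cat flatten_cat catA /=.
by rewrite add1n subn1.
Qed.

Lemma questions_strategy s t : t \in [:: 2; 3; 4] ->
  strategy (3 * s + t) (questions s t).
Proof.
move=> ht; elim: s => [|s [IHu IHc]].
  by move: ht; rewrite !inE => /or3P[] /eqP->.
rewrite questionsS; split; last first.
  rewrite all_cat; apply/andP; split.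
    apply: sub_all IHc => Q; rewrite !code2E; lia.
  by rewrite /= !code2E !(tnth_nth 0) /=; lia.
rewrite cat_uniq IHu andTb; apply/andP; split; last first.
  by rewrite /= !inE -!val_eqE /= !eqseq_cons; lia.
(* All earlier colors are at most [3 * s + t], and all colors of the new block exceed it. *)
apply/hasPn => Q QB; apply/negP => /(allP IHc); rewrite code2E.
by move: QB; rewrite !inE => /or4P[] /eqP->; rewrite !(tnth_nth 0) /=; lia.
Qed.

Lemma size_questions s t : t \in [:: 2; 3; 4] ->
  size (questions s t) = 4 * s + (if t == 2 then 1 else if t == 3 then 2 else 4).
Proof.
move=> ht; elim: s => [|s IH].
  by move: ht; rewrite !inE => /or3P[] /eqP->.
by rewrite questionsS size_cat IH /=; lia.
Qed.

(** * Feasibility of the list: blocks first, then base questions *)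

Lemma block_sub s t l : l < s ->
  {subset block (t + 3 * l) <= questions s t}.
Proof.
elim: s => // s IH; rewrite ltnS leq_eqVlt questionsS => /orP[/eqP->|/IH sub] Q.
  by rewrite mem_cat orbC => ->.
by move=> QB; rewrite mem_cat (sub _ QB).
Qed.

(** The questions of [block d] see only the colors [d + 1], [d + 2], [d + 3]. Sending all others to
    0 leaves finitely many cases to check. *)
Definition collapse d z := if d < z <= d + 3 then z - d else 0.

Lemma eq_collapse d a z : 0 < a <= 3 -> (a + d == z) = (a == collapse d z).
Proof. by rewrite /collapse => ?; case: ifP; lia. Qed.

Lemma collapse_iota d z : collapse d z \in iota 0 4.
Proof. by rewrite mem_iota /collapse; case: ifP; lia. Qed.

Lemma collapse_inj d z z' :
  collapse d z = collapse d z' -> d < z <= d + 3 -> z' = z.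
Proof. by rewrite /collapse => + hz; rewrite hz; case: ifP; lia. Qed.

Lemma block_table : all (fun x => all (fun y => all (fun x' => all (fun y' =>
    [&& (1 == x) + (3 == y) == (1 == x') + (3 == y'),
        (3 == x) + (1 == y) == (3 == x') + (1 == y'),
        (2 == x) + (3 == y) == (2 == x') + (3 == y') &
        (3 == x) + (2 == y) == (3 == x') + (2 == y')] ==>
    (x == x') && (y == y'))
  (iota 0 4)) (iota 0 4)) (iota 0 4)) (iota 0 4).
Proof. by vm_compute. Qed.

Lemma block_determines (d x y x' y' : nat) :
  {in block d, forall Q, (peg1 Q == x) + (peg2 Q == y) =
                         (peg1 Q == x') + (peg2 Q == y')} ->
  (d < x <= d + 3 -> x' = x) /\ (d < y <= d + 3 -> y' = y).
Proof.
move=> H.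
have := (H (question2 (1 + d) (3 + d)), H (question2 (3 + d) (1 + d)),
  H (question2 (2 + d) (3 + d)), H (question2 (3 + d) (2 + d))).
rewrite !inE !eqxx ?orbT !(tnth_nth 0) /= => -[[[h1 h2] h3] h4].
move: (h1 isT) (h2 isT) (h3 isT) (h4 isT).
rewrite !eq_collapse // => e1 e2 e3 e4; have k4 := collapse_iota d.
have /implyP := allP (allP (allP (allP block_table _ (k4 x)) _ (k4 y))
                  _ (k4 x')) _ (k4 y').
rewrite e1 e2 e3 e4 !eqxx.
by move=> /(_ isT) /andP[/eqP ex /eqP ey]; split; apply: collapse_inj.
Qed.

Lemma questions_determines (s t x y x' y' : nat) :
  {in questions s t, forall Q, (peg1 Q == x) + (peg2 Q == y) =
                               (peg1 Q == x') + (peg2 Q == y')} ->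
  (t < x <= 3 * s + t -> x' = x) /\ (t < y <= 3 * s + t -> y' = y).
Proof.
move=> H.
have B l : l < s -> _ := fun h => block_determines (sub_in1 (@block_sub s t l h) H).
split=> h.
  (* Counting from 0, block [l] covers the colors from [t + 3l + 1] to [t + 3l + 3]; this quotient
     is the block containing [x]. *)
  have l_s : (x - t.+1) %/ 3 < s by lia.
  by apply: (B _ l_s).1; lia.
have l_s : (y - t.+1) %/ 3 < s by lia.
by apply: (B _ l_s).2; lia.
Qed.

(** The analogue of [collapse] for the base questions, with 0 for the colors of all blocks. *)
Definition clip t z := if z <= t then z else 0.

Lemma eq_clip t a z : 0 < a <= t -> (a == z) = (a == clip t z).
Proof. by rewrite /clip => ?; case: ifP; lia. Qed.

Lemma clip_iota t z : clip t z \in iota 0 t.+1.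
Proof. by rewrite mem_iota /clip; case: ifP; lia. Qed.

Lemma clip_eq0 t z : 0 < z -> (clip t z == 0) = (t < z).
Proof. by rewrite /clip; case: ifP; lia. Qed.

Lemma clip_inj t z z' : z <= t -> z' <= t -> clip t z = clip t z' -> z = z'.
Proof. by rewrite /clip => -> ->. Qed.

(** Distinct colors may both be clipped to 0, hence the exception for [x == 0]. The agreement of
    zeros is what the blocks supply: for [t = 2], the pairs [(1 | 0)] and [(0 | 2)] get the same
    answer from [(1 | 2)]. *)
Lemma base_table : all (fun t => all (fun x => all (fun y => all (fun x' =>
  all (fun y' =>
    [&& (x != y) || (x == 0), (x' != y') || (x' == 0),
        (x == 0) == (x' == 0), (y == 0) == (y' == 0) &
        all (fun Q => (peg1 Q == x) + (peg2 Q == y) ==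
                      (peg1 Q == x') + (peg2 Q == y')) (base_questions t)] ==>
    (x == x') && (y == y'))
  (iota 0 t.+1)) (iota 0 t.+1)) (iota 0 t.+1)) (iota 0 t.+1)) [:: 2; 3; 4].
Proof. by vm_compute. Qed.

Lemma clip_neq t x y : x != y -> 0 < x -> 0 < y ->
  (clip t x != clip t y) || (clip t x == 0).
Proof. by rewrite /clip; do 2 case: ifP; lia. Qed.

Lemma questions_separating s t : t \in [:: 2; 3; 4] ->
  separating (3 * s + t) (questions s t).
Proof.
move=> ht x y x' y' nxy nxy'.
move=> /andP[x0 xc] /andP[y0 yc] /andP[x'0 x'c] /andP[y'0 y'c] H.
have [Dx Dy] := questions_determines H.
have [Dx' Dy'] :
    (t < x' <= 3 * s + t -> x = x') /\ (t < y' <= 3 * s + t -> y = y').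
  by apply: (@questions_determines s t) => Q /H.
(* On each peg, either the blocks already force equality or both colors are base colors. *)
have split_t (z z' : nat) : z <= 3 * s + t -> z' <= 3 * s + t ->
    (t < z <= 3 * s + t -> z' = z) -> (t < z' <= 3 * s + t -> z = z') ->
    z = z' \/ z <= t /\ z' <= t.
  by move=> hz hz'; rewrite hz hz' !andbT; case: (ltnP t z) => [_ -> //|];
    [left | case: (ltnP t z') => [_ _ _ -> //|]; [left | right]].
have clip0 (z z' : nat) : 0 < z -> 0 < z' -> z = z' \/ z <= t /\ z' <= t ->
    (clip t z == 0) == (clip t z' == 0).
  by move=> z0 z'0 [-> // | [h h']]; rewrite !clip_eq0 // !ltnNge h h'.
have clipI (z z' : nat) : z = z' \/ z <= t /\ z' <= t ->
    clip t z = clip t z' -> z = z'.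
  by move=> [-> // | [h h']]; apply: clip_inj.
have {Dx Dx'} Dx := split_t _ _ xc x'c Dx Dx'.
have {Dy Dy'} Dy := split_t _ _ yc y'c Dy Dy'.
have k := clip_iota t.
have /implyP := allP (allP (allP (allP (allP base_table _ ht) _ (k x)) _ (k y))
                  _ (k x')) _ (k y').
rewrite !clip_neq // !clip0 // !andTb => T.
suff /T /andP[/eqP/clipI ex /eqP/clipI ey] : all
    (fun Q => (peg1 Q == clip t x) + (peg2 Q == clip t y) ==
              (peg1 Q == clip t x') + (peg2 Q == clip t y')) (base_questions t).
  by split; [exact: ex | exact: ey].
apply/allP => Q QB; have Qqs : Q \in questions s t by rewrite mem_cat QB.
(* For [s = 0] the list is the base list, so its colors lie between 1 and [t], where clipping
   changes no comparison. *)
have [_ /allP] := questions_strategy 0 ht.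
rewrite /questions /= cats0 => /(_ _ QB); rewrite code2E => /and3P[_ h1 h2].
by apply/eqP; rewrite -!eq_clip // H.
Qed.

(** * The ceiling, and assembly of the theorem *)

Lemma ceil_four_thirds (c k : nat) : 3 * k < 4 * c + 3 -> 4 * c <= 3 * k ->
  Num.ceil ((4 * c)%:R / 3%:R : rat) = k%:Z%R.
Proof.
move=> h1 h2; apply: ceil_def; apply/andP; split.
  rewrite ltr_pdivlMr ?ltr0n // intrB mulrBl mul1r ltrBlDr.
  by rewrite -[k%:~R%R]/(k%:R%R) -natrM -natrD ltr_nat mulnC.
by rewrite ler_pdivrMr ?ltr0n // -[k%:~R%R]/(k%:R%R) -natrM ler_nat [k * 3]mulnC.
Qed.

Theorem theorem1 (c : nat) (hc : 2 <= c) :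
  (exists! st : nat * nat, st.2 \in [:: 2; 3; 4] /\ c = 3 * st.1 + st.2) /\
  (forall s t : nat, t \in [:: 2; 3; 4] -> c = 3 * s + t ->
     ((size (questions s t))%:Z = Num.ceil ((4 * c)%:R / 3%:R : rat) - 2)%R /\
     optimal c (Num.ceil ((4 * c)%:R / 3%:R : rat) - 1)%R (questions s t)).
Proof.
split.
  exists ((c - 2) %/ 3, 2 + (c - 2) %% 3); split=> [|[s t]] /=.
    by rewrite !inE; lia.
  by rewrite !inE => -[ht e]; congr pair; lia.
move=> s t ht cE; have sz := size_questions s ht.
have ceilE : Num.ceil ((4 * c)%:R / 3%:R : rat) = ((size (questions s t) + 2)%N%:Z)%R.
  by apply: ceil_four_thirds; rewrite sz cE;
    move: ht; rewrite !inE => /or3P[] /eqP-> /=; lia.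
rewrite ceilE; split; first by lia.
split.
- by split; [rewrite cE; exact: questions_strategy | lia].
- by apply/feasible2P; rewrite cE; exact: questions_separating.
- move=> [qs [[u a] /feasible2P F]].
  have := separating_size_ge a u F hc.
  (* Rounded up, [(12s + 4t - 6) / 3] is [4s + 1], [4s + 2], [4s + 4] for [t = 2, 3, 4], exactly the
     length of the list. *)
  rewrite sz cE; move: ht; rewrite !inE => /or3P[] /eqP-> /=; lia.
Qed.
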